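(* For every $n\ge 3$ there exist convex centrally symmetric bodies $K,L$ in the hyperbolic space $\mathbb{H}^n$ (symmetric about a common point $o$) such that $$\mathrm{vol}_{n-1}(K\cap H)\le \mathrm{vol}_{n-1}(L\cap H)$$ for every totally geodesic hyperplane $H$ of $\mathbb{H}^n$ passing through $o$, but $\mathrm{vol}_n(K)>\mathrm{vol}_n(L)$.
   Context: $\mathbb{H}^n$ is realized as the Poincaré ball: the open unit ball $B^n\subset\mathbb{R}^n$ with metric $ds^2=4\frac{dx_1^2+\cdots+dx_n^2}{(1-|x|^2)^2}$, with $o$ the origin. A body is a compact set with non-empty interior; it is convex if for any two of its points the geodesic segment of this metric joining them lies in the body. Centrally symmetric means $K=-K$ in this model. The totally geodesic hyperplanes through $o$ are $\{x:\langle x,\xi\rangle=0\}\cap B^n$, $\xi\in S^{n-1}$. $\mathrm{vol}_n,\mathrm{vol}_{n-1}$ are the Riemannian volumes of the hyperbolic metric. *)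

(* Defs.v *)
From HB Require Import structures.
From mathcomp Require Import all_boot all_order all_algebra.
From mathcomp Require Import all_classical all_reals all_analysis.
Set Implicit Arguments. Unset Strict Implicit. Unset Printing Implicit Defensive.
Import Order.TTheory GRing.Theory Num.Theory.
Import numFieldNormedType.Exports.
Local Open Scope classical_set_scope.
Local Open Scope ring_scope.

Section Hyperbolic.
Variable R : realType.

Definition sqnorm (n : nat) (x : 'rV[R]_n) : R := \sum_(i < n) x ord0 i ^+ 2.
Definition dotv (n : nat) (x y : 'rV[R]_n) : R := \sum_(i < n) x ord0 i * y ord0 i.

(* The open unit ball B^n (the Poincare ball model of H^n). *)
Definition pball (n : nat) : set 'rV[R]_n := [set x | sqnorm x < 1].

(* Hyperbolic distance in the Poincare ball:
   d(x,y) = arcosh (1 + 2|x-y|^2 / ((1-|x|^2)(1-|y|^2))),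
   with arcosh t = ln (t + sqrt (t^2 - 1)). *)
Definition hdist (n : nat) (x y : 'rV[R]_n) : R :=
  let t := 1 + 2 * sqnorm (x - y) / ((1 - sqnorm x) * (1 - sqnorm y)) in
  ln (t + Num.sqrt (t ^+ 2 - 1)).

(* Geodesic segment joining x and y (H^n is uniquely geodesic, so the
   segment is exactly the set of metric-between points). *)
Definition hsegment (n : nat) (x y : 'rV[R]_n) : set 'rV[R]_n :=
  [set z | @pball n z /\ hdist x z + hdist z y = hdist x y].

Definition hconvex (n : nat) (K : set 'rV[R]_n) : Prop :=
  forall x y, K x -> K y -> hsegment x y `<=` K.

Definition hbody (n : nat) (K : set 'rV[R]_n) : Prop :=
  K `<=` @pball n /\ compact K /\ (interior K !=set0).

Definition csym (n : nat) (K : set 'rV[R]_n) : Prop := K = (-%R) @` K.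

Definition vcons (m : nat) (a : R) (v : 'rV[R]_m) : 'rV[R]_m.+1 :=
  \row_(i < m.+1) match unlift ord0 i with Some j => v ord0 j | None => a end.

(* n-dimensional Lebesgue integral of a non-negative function, as the
   iterated one-dimensional Lebesgue integral (Tonelli). *)
Fixpoint iint (n : nat) : ('rV[R]_n -> \bar R) -> \bar R :=
  match n with
  | 0 => fun f => f 0
  | m.+1 => fun f =>
      (\int[@lebesgue_measure R]_(a in [set: R]) iint (fun v => f (vcons a v)))%E
  end.

(* Conformal density of the hyperbolic k-volume: (2/(1-|x|^2))^k. *)
Definition hdens (n k : nat) (x : 'rV[R]_n) : R := (2 / (1 - sqnorm x)) ^+ k.

Definition hvol (n : nat) (K : set 'rV[R]_n) : \bar R :=
  iint (fun x => ((\1_(K `&` @pball n) x : R) * hdens n x)%:E).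

(* Hyperbolic (n-1)-volume of K \cap H where H = U(R^(n-1)) and the rows of
   U : 'M_(n-1,n) form an orthonormal basis of H. *)
Definition hvol_sec (n : nat) (U : 'M[R]_(n.-1, n)) (K : set 'rV[R]_n) : \bar R :=
  iint (fun y : 'rV[R]_n.-1 =>
          ((\1_(K `&` @pball n) (y *m U) : R) * hdens n.-1 y)%:E).

Definition hyperplane_frame (n : nat) (xi : 'rV[R]_n) (U : 'M[R]_(n.-1, n)) : Prop :=
  U *m U^T = 1%:M /\ U *m xi^T = 0.

End Hyperbolic.

(* Main.v *)
(* For [r] close to 1, let [L] be the hyperbolic ball of Euclidean radius [r] truncated by a
   fixed ellipsoid of the Klein model ([bulge]), which leaves two polar caps near the sphere
   at infinity. To get [K], shave a fixed collar off [L] around the equator (intersection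
   with the cylinder [waist]) and raise the two caps slightly, replacing [r] by [r' > r].
   Since [n - 1 >= 2], every central hyperplane contains an equatorial direction, so it
   loses at least a fixed (n-1)-volume [v] with the collar; it gains at most the
   (n-1)-volume of the shell between the radii [r] and [r'], and [r'] is chosen so that this
   is at most [v]. The n-volume gained by the caps exceeds the (n-1)-volume of that shell by
   a factor of order [1 / (1 - r)], hence beats the bounded n-volume of the collar
   as [r] tends to 1. *)
Require Import Defs.
From HB Require Import structures.
From mathcomp Require Import all_boot all_order all_algebra.
From mathcomp Require Import all_classical all_reals all_analysis.
From mathcomp Require Import measurable_realfun.
From mathcomp Require Import ring lra.
Import Order.TTheory GRing.Theory Num.Theory.
Import numFieldNormedType.Exports.
Set Implicit Arguments. Unset Strict Implicit. Unset Printing Implicit Defensive.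
Local Open Scope classical_set_scope.
Local Open Scope ring_scope.

(** * Iterated integrals *)

Section IteratedIntegral.
Variable R : realType.
Local Notation mu := (@lebesgue_measure R).

(* Testing measurability along measurable coordinate maps replaces a product
   sigma-algebra on ['rV[R]_n], which the library does not provide. *)
Definition rv_measurable d (E : measurableType d) (n : nat) (f : 'rV[R]_n -> E) : Prop :=
  forall d' (S : measurableType d') (x : 'I_n -> S -> R),
    (forall i, measurable_fun setT (x i)) ->
    measurable_fun setT (fun s => f (\row_i x i s)).

Lemma vcons_row n (a : R) (v : 'I_n -> R) :
  vcons a (\row_i v i) = \row_i (if unlift ord0 i is Some j then v j else a).
Proof. by apply/rowP => i; rewrite !mxE; case: unlift => // j; rewrite mxE. Qed.

(** Tonelli for the iterated integral. The parameter space [T] is arbitrary so that the induction on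
    [n] can absorb the outermost integration variable: the induction hypothesis is applied over
    [T * R]. *)
Lemma measurable_iint n d (T : measurableType d) (f : T -> 'rV[R]_n -> \bar R) :
  (forall t v, 0 <= f t v)%E ->
  (forall d' (S : measurableType d') (phi : S -> T) (x : 'I_n -> S -> R),
    measurable_fun setT phi -> (forall i, measurable_fun setT (x i)) ->
    measurable_fun setT ((fun s => f (phi s) (\row_i x i s)) : S -> \bar R)) ->
  (forall t, 0 <= iint (f t))%E /\
  measurable_fun setT ((fun t => iint (f t)) : T -> \bar R).
Proof.
elim: n d T f => [|n IH] d T f f0 fm.
  split=> //=.
  rewrite (_ : (fun t => _) = fun t => f t (\row_i (fun (_ : 'I_0) (_ : T) => 0 : R) i t)).
    by apply: fm => //; exact: measurable_id.
  by apply/funext => t; congr (f t); apply/rowP => -[].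
have [g0 gm] : (forall p : T * R, 0 <= iint (fun v => f p.1 (vcons p.2 v)))%E /\
    measurable_fun setT ((fun p => iint (fun v => f p.1 (vcons p.2 v))) : T * R -> \bar R).
  apply: (IH _ _ (fun (p : T * R) v => f p.1 (vcons p.2 v))) => // d' S phi x mphi mx.
  under eq_fun do rewrite vcons_row.
  apply: (fm _ _ (fun s => (phi s).1)
    (fun i s => if unlift ord0 i is Some j then x j s else (phi s).2)).
    exact: measurableT_comp.
  move=> i; case: unlift => [j|//]; exact: measurableT_comp.
split=> [t /=|]; first by apply: integral_ge0 => a _; exact: (g0 (t, a)).
exact: (@measurable_fun_fubini_tonelli_F _ _ _ _ _ mu _ gm g0).
Qed.

Lemma rv_measurable_slice n d (E : measurableType d) (f : 'rV[R]_n.+1 -> E) a :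
  rv_measurable f -> rv_measurable (fun v => f (vcons a v)).
Proof.
move=> fm d' S x mx; under eq_fun do rewrite vcons_row.
by apply: (fm _ _ (fun i s => if unlift ord0 i is Some j then x j s else a)) => i; case: unlift.
Qed.

Lemma iint_ge0 n (f : 'rV[R]_n -> \bar R) : (forall v, 0 <= f v)%E -> (0 <= iint f)%E.
Proof.
elim: n f => [|n IH] f f0 //=.
by apply: integral_ge0 => a _; exact: IH.
Qed.

Lemma measurable_iint_slice n (f : 'rV[R]_n.+1 -> \bar R) :
  (forall v, 0 <= f v)%E -> rv_measurable f ->
  measurable_fun setT ((fun a => iint (fun v => f (vcons a v))) : R -> \bar R).
Proof.
move=> f0 fm; apply: (@measurable_iint n _ _ (fun a v => f (vcons a v)) _ _).2 => //.
move=> d' S phi x mphi mx; under eq_fun do rewrite vcons_row.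
by apply: (fm _ _ (fun i s => if unlift ord0 i is Some j then x j s else phi s)) => i; case: unlift.
Qed.

Lemma iintD n (f g : 'rV[R]_n -> \bar R) :
  (forall v, 0 <= f v)%E -> (forall v, 0 <= g v)%E ->
  rv_measurable f -> rv_measurable g ->
  iint (fun v => f v + g v)%E = (iint f + iint g)%E.
Proof.
elim: n f g => [|n IH] f g f0 g0 fm gm //=.
rewrite -ge0_integralD//.
- apply: eq_integral => a _; exact: IH (rv_measurable_slice _ _) (rv_measurable_slice _ _).
- by move=> a _; exact: iint_ge0.
- exact: measurable_iint_slice.
- by move=> a _; exact: iint_ge0.
- exact: measurable_iint_slice.
Qed.

Lemma iintZl n (k : R) (f : 'rV[R]_n -> \bar R) :
  0 <= k -> (forall v, 0 <= f v)%E -> rv_measurable f ->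
  iint (fun v => k%:E * f v)%E = (k%:E * iint f)%E.
Proof.
move=> k0; elim: n f => [|n IH] f f0 fm //=.
rewrite -ge0_integralZl//.
- apply: eq_integral => a _; exact: IH (rv_measurable_slice _ _).
- exact: measurable_iint_slice.
- by move=> a _; exact: iint_ge0.
Qed.

Lemma le_iint n (f g : 'rV[R]_n -> \bar R) :
  (forall v, 0 <= f v)%E -> (forall v, f v <= g v)%E ->
  rv_measurable f -> rv_measurable g -> (iint f <= iint g)%E.
Proof.
elim: n f g => [|n IH] f g f0 fg fm gm //=.
have g0 v : (0 <= g v)%E by apply: le_trans (fg v).
apply: ge0_le_integral => //.
- by move=> a _; exact: iint_ge0.
- exact: measurable_iint_slice.
- exact: measurable_iint_slice.
- move=> a _; exact: IH (rv_measurable_slice _ _) (rv_measurable_slice _ _).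
Qed.

Lemma eq_iint n (f g : 'rV[R]_n -> \bar R) : f =1 g -> iint f = iint g.
Proof. by move=> /funext ->. Qed.

(** The image of Lebesgue measure under multiplication by [c], weighted by [c], agrees with Lebesgue
    measure on half-open intervals, hence everywhere by uniqueness. *)
Lemma integral_scale (c : R) (f : R -> \bar R) : 0 < c ->
  measurable_fun setT f -> (forall a, 0 <= f a)%E ->
  (c%:E * \int[mu]_(a in setT) f (c * a)%R = \int[mu]_(a in setT) f a)%E.
Proof.
move=> c0 fm f0.
pose phi : measurableTypeR R -> measurableTypeR R := *%R c.
have mphi : measurable_fun setT phi by exact: measurable_funM.
pose nu0 : {measure set (measurableTypeR R) -> \bar R} := pushforward mu phi.
pose nu := nu0 mphi.
pose m : {measure set (measurableTypeR R) -> \bar R} := mscale (NngNum (ltW c0)) nu.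
transitivity (c%:E * \int[nu]_(a in setT) f a)%E.
  by rewrite ge0_integral_pushforward.
transitivity (\int[m]_(a in setT) f a)%E.
  by rewrite ge0_integral_mscale.
apply: eq_measure_integral => /= A mA _.
apply/esym.
apply: (@lebesgue_measure_unique R m) => //= _ [[a b]] _ <-.
rewrite /m /mscale /= /nu /pushforward.
rewrite (_ : phi @^-1` _ = `](c^-1 * a), (c^-1 * b)]%classic); last first.
  apply/seteqP; split=> x /=; rewrite /phi !in_itv /= ltr_pdivrMl// ler_pdivlMl//.
rewrite !lebesgue_measure_itv/= !lte_fin ltr_pM2l ?invr_gt0//.
case: ifPn => _; last by rewrite mule0.
by rewrite -!EFinD -EFinM -mulrBr mulrA divff ?gt_eqF// mul1r.
Qed.

Lemma iint_scale n (c : R) (f : 'rV[R]_n -> \bar R) : 0 < c ->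
  (forall v, 0 <= f v)%E -> rv_measurable f ->
  ((c ^+ n)%:E * iint (fun v => f (c *: v)) = iint f)%E.
Proof.
move=> c0; elim: n f => [|n IH] f f0 fm /=.
  by rewrite expr0 mul1e scaler0.
rewrite -[RHS](integral_scale c0); last 2 first.
- exact: measurable_iint_slice.
- by move=> a; exact: iint_ge0.
rewrite exprS EFinM -muleA; congr (_ * _)%E.
have vconsZ a (v : 'rV[R]_n) : c *: vcons a v = vcons (c * a) (c *: v).
  by apply/rowP => i; rewrite !mxE; case: unlift => // j; rewrite mxE.
rewrite -ge0_integralZl//.
- apply: eq_integral => a _.
  under eq_fun do rewrite vconsZ.
  apply: (IH (fun v => f (vcons (c * a) v))) => //; exact: rv_measurable_slice.
- apply: (measurable_iint_slice (f := fun v => f (c *: v))) => // d' S x mx.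
  rewrite (_ : (fun s => _) = fun s => f (\row_i (c * x i s))).
    by apply: (fm _ _ (fun i s => c * x i s)) => i; exact: measurable_funM.
  by apply/funext => s; congr f; apply/rowP => i; rewrite !mxE.
- by move=> a _; exact: iint_ge0.
- by rewrite lee_fin exprn_ge0// ltW.
Qed.

(** * Measurable functions and sets of row vectors *)

Lemma rv_measurable_sqnorm n : rv_measurable (@sqnorm R n).
Proof.
move=> d' S x mx; rewrite /sqnorm; under eq_fun do under eq_bigr do rewrite mxE.
apply: measurable_sum => i; apply: measurable_funX; exact: mx.
Qed.

Lemma rv_measurable_coord n (i : 'I_n) : rv_measurable (fun x : 'rV[R]_n => x ord0 i).
Proof. by move=> d' S x mx; under eq_fun do rewrite mxE; exact: mx. Qed.

Lemma rv_measurable_cst n (a : R) : rv_measurable (fun _ : 'rV[R]_n => a).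
Proof. by []. Qed.

Lemma rv_measurableD n (f g : 'rV[R]_n -> R) :
  rv_measurable f -> rv_measurable g -> rv_measurable (fun x => f x + g x).
Proof. by move=> fm gm d' S x mx; apply: measurable_funD; [exact: fm|exact: gm]. Qed.

Lemma rv_measurableM n (f g : 'rV[R]_n -> R) :
  rv_measurable f -> rv_measurable g -> rv_measurable (fun x => f x * g x).
Proof. by move=> fm gm d' S x mx; apply: measurable_funM; [exact: fm|exact: gm]. Qed.

Lemma rv_measurableX n (f : 'rV[R]_n -> R) k :
  rv_measurable f -> rv_measurable (fun x => f x ^+ k).
Proof. by move=> fm d' S x mx; apply: measurable_funX; exact: fm. Qed.

(** Inversion is the real power [-1] on nonnegative numbers, extended as an odd function; at [0]
    both conventions give [0]. *)
Lemma measurable_invr : measurable_fun setT (@GRing.inv R).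
Proof.
rewrite (_ : @GRing.inv R = fun z => if 0 <= z then powR z (-1) else - powR (- z) (-1)).
  apply: measurable_fun_ifT => /=.
  - exact: measurable_fun_ler.
  - exact: measurable_powR.
  - apply: measurable_funN; apply: (measurableT_comp (measurable_powR _)).
    exact: measurable_funN.
apply/funext => z; case: ifPn => [z0|]; first by rewrite powR_inv1.
by rewrite -ltNge => /ltW z0; rewrite powR_inv1 ?oppr_ge0// invrN opprK.
Qed.

Lemma rv_measurableV n (f : 'rV[R]_n -> R) :
  rv_measurable f -> rv_measurable (fun x => (f x)^-1).
Proof. by move=> fm d' S x mx; apply: (measurableT_comp measurable_invr); exact: fm. Qed.

Lemma rv_measurable_hdens n k : rv_measurable (@hdens R n k).
Proof.
apply: (@rv_measurableX n (fun x => 2 / (1 - sqnorm x))).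
apply: rv_measurableM; first exact: rv_measurable_cst.
apply: rv_measurableV; apply: rv_measurableD; first exact: rv_measurable_cst.
move=> d' S x mx; apply: measurable_funN; exact: rv_measurable_sqnorm.
Qed.

Definition rv_mset n (A : set 'rV[R]_n) : Prop := rv_measurable (\1_A : 'rV[R]_n -> R).

Lemma rv_mset_le n (f g : 'rV[R]_n -> R) :
  rv_measurable f -> rv_measurable g -> rv_mset [set x | f x <= g x].
Proof.
move=> fm gm d' S x mx.
rewrite (_ : (fun s => _) = \1_[set s | f (\row_i x i s) <= g (\row_i x i s)]).
  apply: measurable_indic; rewrite -[X in measurable X]setTI.
  by apply: measurable_fun_le => //; [exact: fm|exact: gm].
by [].
Qed.

Lemma rv_msetI n (A B : set 'rV[R]_n) : rv_mset A -> rv_mset B -> rv_mset (A `&` B).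
Proof. by move=> mA mB; rewrite /rv_mset indicI; exact: rv_measurableM. Qed.

Lemma rv_msetD n (A B : set 'rV[R]_n) : rv_mset A -> rv_mset B -> rv_mset (A `\` B).
Proof.
move=> mA mB; rewrite /rv_mset.
rewrite (_ : \1__ = fun x => \1_A x * (1 + (-1) * \1_B x)).
  do ![apply: rv_measurableM|apply: rv_measurableD|exact: rv_measurable_cst] => //.
apply/funext => x; rewrite !indicE in_setD.
by case: (x \in A); case: (x \in B) => /=; rewrite ?mul0r// mul1r; ring.
Qed.


Lemma rv_measurable_mulmx n m d (E : measurableType d) (U : 'M[R]_(n, m)) (f : 'rV[R]_m -> E) :
  rv_measurable f -> rv_measurable (fun y => f (y *m U)).
Proof.
move=> fm d' S x mx.
rewrite (_ : (fun s => _) = fun s => f (\row_j \sum_i x i s * U i j)).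
  apply: (fm _ _ (fun j s => \sum_i x i s * U i j)) => j.
  by apply: measurable_sum => i; apply: measurable_funM => //; exact: mx.
apply/funext => s; congr f; apply/rowP => j; rewrite !mxE.
by apply: eq_bigr => i _; rewrite mxE.
Qed.

Lemma rv_measurable_EFin n (f : 'rV[R]_n -> R) :
  rv_measurable f -> rv_measurable (fun x => (f x)%:E).
Proof. by move=> fm d' S x mx; apply/measurable_EFinP; exact: fm. Qed.

(** * Euclidean volumes of cubes, cones and shells *)

Definition cube n (w : 'rV[R]_n) (t : R) : set 'rV[R]_n :=
  [set x | forall i, `|x ord0 i - w ord0 i| <= t].

Lemma rv_mset_cube n (w : 'rV[R]_n) t : rv_mset (cube w t).
Proof.
move=> d' S x mx.
rewrite (_ : (fun s => _) =
  \1_(\bigcap_(i in [set: 'I_n]) [set s | `|x i s - w ord0 i| <= t])).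
  apply: measurable_indic; apply: fin_bigcap_measurable; first exact: finite_finset.
  move=> i _; rewrite -[X in measurable X]setTI.
  apply: measurable_fun_le => //.
  apply: (measurableT_comp (@normr_measurable R setT)).
  by apply: measurable_funB => //; exact: mx.
apply/funext => s; rewrite !indicE; congr (_%:R); congr nat_of_bool.
apply/idP/idP; rewrite !inE => h i; last by rewrite mxE; exact: h.
by move=> _; have := h i; rewrite mxE.
Qed.

Lemma vcons0 n (a : R) (v : 'rV[R]_n) : vcons a v ord0 ord0 = a.
Proof. by rewrite mxE unlift_none. Qed.

Lemma vcons_lift n (a : R) (v : 'rV[R]_n) i : vcons a v ord0 (lift ord0 i) = v ord0 i.
Proof. by rewrite mxE liftK. Qed.

Lemma iint_cube n (w : 'rV[R]_n) t : 0 <= t ->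
  iint (fun x => (\1_(cube w t) x)%:E) = ((2 * t) ^+ n)%:E.
Proof.
move=> t0; elim: n w => [|n IH] w /=.
  by rewrite expr0 indicE mem_set// => -[].
pose w' : 'rV[R]_n := \row_i w ord0 (lift ord0 i).
have cubeS a v : \1_(cube w t) (vcons a v) =
    \1_`[w ord0 ord0 - t, w ord0 ord0 + t]%classic a * \1_(cube w' t) v :> R.
  rewrite !indicE -natrM mulnb; congr (_%:R); congr nat_of_bool.
  apply/idP/andP; rewrite !inE /= in_itv /= -ler_distlC.
    move=> h; split; first by have := h ord0; rewrite vcons0 distrC.
    by move=> i; have := h (lift ord0 i); rewrite vcons_lift mxE.
  move=> [h0 h] i; case: (unliftP ord0 i) => [j|] ->.
    by rewrite vcons_lift; have := h j; rewrite mxE.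
  by rewrite vcons0 distrC.
under eq_integral => a _.
  under eq_fun do rewrite cubeS EFinM.
  rewrite iintZl//; last exact: rv_measurable_EFin (rv_mset_cube _ _).
  rewrite IH muleC.
  over.
rewrite ge0_integralZl//; last 2 first.
- by apply/measurable_EFinP; exact: measurable_indic.
- by rewrite lee_fin exprn_ge0// mulr_ge0.
rewrite integral_indic// setIT /= lebesgue_measure_itv /= lte_fin.
(* The length formula treats a degenerate interval as a separate case; the dimension [n.+1] is
   positive, so the right-hand power vanishes as well. *)
have [->|tn0] := eqVneq t 0.
  by rewrite subr0 addr0 ltxx mulr0 mule0 exprS mul0r.
rewrite ifT; last by rewrite ltrBlDr -addrA ltrDl -mulr2n pmulrn_lgt0// lt_neqAle eq_sym tn0.
by rewrite -EFinD -EFinM exprSr; congr (_ * _)%:E; ring.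
Qed.

Definition vol n (A : set 'rV[R]_n) : \bar R := iint (fun x => (\1_A x)%:E).

Lemma vol_ge0 n (A : set 'rV[R]_n) : (0 <= vol A)%E.
Proof. by apply: iint_ge0 => v; rewrite lee_fin indicE. Qed.

Lemma le_indic n (A B : set 'rV[R]_n) x : A `<=` B -> \1_A x <= \1_B x :> R.
Proof.
move=> AB; rewrite !indicE; case: (boolP (x \in A)) => [/set_mem/AB/mem_set ->|_] //.
Qed.

Lemma le_vol n (A B : set 'rV[R]_n) : rv_mset A -> rv_mset B -> A `<=` B -> (vol A <= vol B)%E.
Proof.
move=> mA mB AB; apply: le_iint => [x|x||]; first by rewrite lee_fin indicE.
- by rewrite lee_fin; exact: le_indic.
- exact: rv_measurable_EFin.
- exact: rv_measurable_EFin.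
Qed.

(** The closed Euclidean ball about the origin; for [0 < r < 1] it is also a hyperbolic ball about
    [o]. *)
Definition oball n (r : R) : set 'rV[R]_n := [set x | sqnorm x <= r ^+ 2].

Lemma rv_mset_oball n r : rv_mset (@oball n r).
Proof. by apply: rv_mset_le; [exact: rv_measurable_sqnorm|exact: rv_measurable_cst]. Qed.

Lemma sqnormZ n (a : R) (x : 'rV[R]_n) : sqnorm (a *: x) = a ^+ 2 * sqnorm x.
Proof. by rewrite /sqnorm mulr_sumr; apply: eq_bigr => i _; rewrite !mxE exprMn. Qed.

(** The dilation by [r] carries the part of the cone in the unit ball onto the part in the ball of
    radius [r]. *)
Lemma vol_cone_ball n (C : set 'rV[R]_n) r : rv_mset C -> 0 < r ->
  (forall x, C (r *: x) <-> C x) ->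
  vol (C `&` @oball n r) = ((r ^+ n)%:E * vol (C `&` @oball n 1))%E.
Proof.
move=> mC r0 Cr; rewrite /vol -(iint_scale r0); last 2 first.
- by move=> v; rewrite lee_fin indicE.
- by apply: rv_measurable_EFin; apply: rv_msetI => //; exact: rv_mset_oball.
congr (_ * _)%E; apply: eq_iint => x; rewrite !indicE; congr (_%:R%:E); congr nat_of_bool.
apply/idP/idP; rewrite !inE /oball /= sqnormZ => -[/Cr h1 h2]; split=> //.
  by move: h2; rewrite expr1n -{2}[r ^+ 2]mulr1 ler_pM2l ?exprn_gt0.
by rewrite -{2}[r ^+ 2]mulr1 ler_pM2l ?exprn_gt0//; move: h2; rewrite expr1n.
Qed.

Lemma vol_cone_oball1_fin n (C : set 'rV[R]_n) : rv_mset C ->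
  (vol (C `&` @oball n 1) \is a fin_num)%E.
Proof.
move=> mC; rewrite ge0_fin_numE ?vol_ge0//.
apply: (@le_lt_trans _ _ (vol (cube (0 : 'rV[R]_n) 1))); last by rewrite /vol iint_cube// ltry.
apply: le_vol; first by apply: rv_msetI => //; exact: rv_mset_oball.
  exact: rv_mset_cube.
move=> x [_]; rewrite /oball /= expr1n => h i; rewrite mxE subr0.
have : x ord0 i ^+ 2 <= 1.
  apply: le_trans h; rewrite /sqnorm (bigD1 i)//= lerDl.
  by apply: sumr_ge0 => j _; exact: sqr_ge0.
by rewrite -real_normK ?num_real// expr_le1//.
Qed.

(** The shell is the difference of two dilates of one set of finite volume. The cone will be the
    whole space for sections and [double_cone] for the caps. *)
Lemma vol_cone_shell n (C : set 'rV[R]_n) r r' : rv_mset C -> 0 < r -> r <= r' ->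
  (forall c x, 0 < c -> C (c *: x) <-> C x) ->
  vol (C `&` (@oball n r' `\` @oball n r)) =
  ((r' ^+ n - r ^+ n) * fine (vol (C `&` @oball n 1)))%:E.
Proof.
move=> mC r0 rr' Cr; have r'0 : 0 < r' by apply: lt_le_trans rr'.
have mB s : rv_mset (C `&` @oball n s) by apply: rv_msetI => //; exact: rv_mset_oball.
have mS : rv_mset (C `&` (@oball n r' `\` @oball n r)).
  by apply: rv_msetI => //; apply: rv_msetD; exact: rv_mset_oball.
have E : vol (C `&` @oball n r') =
    (vol (C `&` (@oball n r' `\` @oball n r)) + vol (C `&` @oball n r))%E.
  rewrite /vol -iintD; last 4 first.
  - by move=> v; rewrite lee_fin indicE.
  - by move=> v; rewrite lee_fin indicE.
  - exact: rv_measurable_EFin mS.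
  - exact: rv_measurable_EFin (mB r).
  apply: eq_iint => x; rewrite -EFinD !indicE -natrD; congr (_%:R%:E).
  rewrite 2!in_setI in_setD in_setI; case: (x \in C) => //=.
  have [xr|xr] := boolP (x \in @oball n r); last by rewrite andbT addn0.
  rewrite andbF add0n; congr nat_of_bool; apply/mem_set; move/set_mem: xr.
  by rewrite /oball /= => /le_trans; apply; rewrite ler_pXn2r// nnegrE ltW.
have scale s : 0 < s -> vol (C `&` @oball n s) = ((s ^+ n)%:E * vol (C `&` @oball n 1))%E.
  by move=> s0; apply: vol_cone_ball => // x; exact: Cr.
move: E; rewrite (scale r')// (scale r)//.
rewrite -(fineK (vol_cone_oball1_fin mC)) -!EFinM.
case: (vol (C `&` (_ `\` _))) (vol_ge0 (C `&` (@oball n r' `\` @oball n r))) => //= v _.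
by rewrite -EFinD => -[] E; congr EFin; rewrite mulrBl E addrK.
Qed.

End IteratedIntegral.

(** * Convexity in the Poincare ball *)

Section HyperbolicConvexity.
Variable R : realType.

Lemma sqnorm_ge0 n (x : 'rV[R]_n) : 0 <= sqnorm x.
Proof. by apply: sumr_ge0 => i _; rewrite sqr_ge0. Qed.

Lemma sqnorm_eq0 n (x : 'rV[R]_n) : sqnorm x = 0 -> x = 0.
Proof.
move=> /eqP; rewrite /sqnorm psumr_eq0 => [/allP h|i _]; last exact: sqr_ge0.
apply/rowP => i; rewrite mxE; apply/eqP.
by rewrite -sqrf_eq0; exact: (h i (mem_index_enum i)).
Qed.

Lemma sqnorm_lin n (a b : R) (x y : 'rV[R]_n) :
  sqnorm (a *: x + b *: y) = a ^+ 2 * sqnorm x + 2 * a * b * dotv x y + b ^+ 2 * sqnorm y.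
Proof.
rewrite /sqnorm /dotv !mulr_sumr -!big_split /=.
by apply: eq_bigr => i _; rewrite !mxE; ring.
Qed.

Lemma dotv_lin n (a b : R) (x y z : 'rV[R]_n) :
  dotv (a *: x + b *: y) z = a * dotv x z + b * dotv y z.
Proof.
rewrite /dotv !mulr_sumr -big_split /=.
by apply: eq_bigr => i _; rewrite !mxE; ring.
Qed.

Lemma dotvC n (x y : 'rV[R]_n) : dotv x y = dotv y x.
Proof. by apply: eq_bigr => i _; rewrite mulrC. Qed.

Lemma dotvv n (x : 'rV[R]_n) : dotv x x = sqnorm x.
Proof. by apply: eq_bigr => i _; rewrite expr2. Qed.

(** Cauchy-Schwarz: expand the square norm of [|y|^2 x - <x,y> y] and divide by [|y|^2]. *)
Lemma dotv_sq_le n (x y : 'rV[R]_n) : dotv x y ^+ 2 <= sqnorm x * sqnorm y.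
Proof.
have [y0|y0] := eqVneq (sqnorm y) 0.
  rewrite (sqnorm_eq0 y0) /dotv big1 ?expr0n /=; last by move=> i _; rewrite mxE mulr0.
  by rewrite mulr_ge0 ?sqnorm_ge0.
have yp : 0 < sqnorm y by rewrite lt_neqAle eq_sym y0 sqnorm_ge0.
have := sqnorm_ge0 (sqnorm y *: x + (- dotv x y) *: y).
rewrite sqnorm_lin => h.
rewrite -subr_ge0 -(pmulr_rge0 _ yp).
by move: h; congr (0 <= _); ring.
Qed.

(* [x |-> (lift0 x, liftv x)] is the isometry onto the hyperboloid model, where
   [coshd] is minus the Lorentz product and geodesics span 2-planes. *)
Definition lift0 n (x : 'rV[R]_n) : R := (1 + sqnorm x) / (1 - sqnorm x).
Definition liftv n (x : 'rV[R]_n) : 'rV[R]_n := (2 / (1 - sqnorm x)) *: x.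

Lemma lift0_gt0 n (x : 'rV[R]_n) : pball x -> 0 < lift0 x.
Proof.
rewrite /pball /= => xb; rewrite /lift0 divr_gt0 ?subr_gt0//.
by rewrite ltr_pwDl ?sqnorm_ge0.
Qed.

Lemma lift_hyperboloid n (x : 'rV[R]_n) : pball x -> lift0 x ^+ 2 - sqnorm (liftv x) = 1.
Proof.
rewrite /pball /= => xb; have x0 : 1 - sqnorm x != 0 by rewrite gt_eqF ?subr_gt0.
have -> : sqnorm (liftv x) = (2 / (1 - sqnorm x)) ^+ 2 * sqnorm x.
  by rewrite /sqnorm /liftv mulr_sumr; apply: eq_bigr => i _; rewrite !mxE exprMn.
by rewrite /lift0; field.
Qed.

(** The argument of arcosh in [hdist], that is, the hyperbolic cosine of the distance. *)
Definition coshd n (x y : 'rV[R]_n) : R :=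
  1 + 2 * sqnorm (x - y) / ((1 - sqnorm x) * (1 - sqnorm y)).

Lemma coshd_lift n (x y : 'rV[R]_n) : pball x -> pball y ->
  coshd x y = lift0 x * lift0 y - dotv (liftv x) (liftv y).
Proof.
rewrite /pball /= => xb yb.
have x0 : 1 - sqnorm x != 0 by rewrite gt_eqF ?subr_gt0.
have y0 : 1 - sqnorm y != 0 by rewrite gt_eqF ?subr_gt0.
have -> : dotv (liftv x) (liftv y) = (2 / (1 - sqnorm x)) * (2 / (1 - sqnorm y)) * dotv x y.
  by rewrite /dotv mulr_sumr; apply: eq_bigr => i _; rewrite !mxE; ring.
rewrite /coshd; have -> : x - y = 1 *: x + (-1) *: y by rewrite scale1r scaleN1r.
rewrite /lift0 sqnorm_lin; field.
by rewrite x0 y0.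
Qed.

Lemma coshd_ge1 n (x y : 'rV[R]_n) : pball x -> pball y -> 1 <= coshd x y.
Proof.
rewrite /pball /= => xb yb; rewrite lerDl divr_ge0 ?mulr_ge0 ?sqnorm_ge0//.
by rewrite subr_ge0 ltW. by rewrite subr_ge0 ltW.
Qed.

Lemma coshd_eq1 n (x y : 'rV[R]_n) : pball x -> pball y -> coshd x y = 1 -> x = y.
Proof.
rewrite /pball /= => xb yb /eqP; rewrite -subr_eq0 /coshd addrC addKr.
have d0 : (1 - sqnorm x) * (1 - sqnorm y) != 0 by rewrite gt_eqF// mulr_gt0 ?subr_gt0.
rewrite mulf_eq0 invr_eq0 (negPf d0) orbF mulf_eq0 pnatr_eq0 /=.
by move=> /eqP /sqnorm_eq0 /eqP; rewrite subr_eq0 => /eqP.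
Qed.

(** These are the addition formulas for cosh and sinh, with [s u] the sinh of arcosh [u].
    Exponentiating makes the numbers [u + s u] multiply; so do their inverses [u - s u], and half
    the sum and half the difference of the two equations give the claim. *)
Lemma arcosh_add (t1 t2 t : R) : 1 <= t1 -> 1 <= t2 -> 1 <= t ->
  let s u := Num.sqrt (u ^+ 2 - 1) in
  ln (t1 + s t1) + ln (t2 + s t2) = ln (t + s t) ->
  t = t1 * t2 + s t1 * s t2 /\ s t = t1 * s t2 + t2 * s t1.
Proof.
move=> h1 h2 h s.
have pos u : 1 <= u -> 0 < u + s u by move=> hu; rewrite ltr_wpDr ?sqrtr_ge0//; lra.
have sq u : 1 <= u -> s u ^+ 2 = u ^+ 2 - 1.
  by move=> hu; rewrite sqr_sqrtr// subr_ge0 expr_ge1//; lra.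
rewrite -lnM ?posrE ?pos// => /ln_inj; rewrite !posrE ?mulr_gt0 ?pos// => /(_ isT isT) E.
have inv u : 1 <= u -> (u + s u) * (u - s u) = 1.
  by move=> hu; rewrite mulrC -subr_sqr sq//; ring.
have F : (t1 - s t1) * (t2 - s t2) = t - s t.
  have p0 : t + s t != 0 by rewrite gt_eqF ?pos.
  apply: (mulfI p0); rewrite inv// -{1}E.
  transitivity (((t1 + s t1) * (t1 - s t1)) * ((t2 + s t2) * (t2 - s t2))); first by ring.
  by rewrite !inv// mulr1.
split; nra.
Qed.

(** The equality case of the triangle inequality. The vector [w = s z - s2 x - s1 y] is
    Lorentz-orthogonal to [x], [y] and [z], hence to itself, so it is null. Cauchy-Schwarz against
    the timelike [x] gives [w0^2 x0^2 <= w0^2 (x0^2 - 1)], so [w0 = 0] and then [w = 0]. *)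
Lemma lorentz_collinear n (x0 y0 z0 t1 t2 t s1 s2 s : R) (x y z : 'rV[R]_n) :
  x0 ^+ 2 - sqnorm x = 1 -> y0 ^+ 2 - sqnorm y = 1 -> z0 ^+ 2 - sqnorm z = 1 ->
  x0 * z0 - dotv x z = t1 -> z0 * y0 - dotv z y = t2 -> x0 * y0 - dotv x y = t ->
  s1 ^+ 2 = t1 ^+ 2 - 1 -> s2 ^+ 2 = t2 ^+ 2 - 1 ->
  t = t1 * t2 + s1 * s2 -> s = t1 * s2 + t2 * s1 ->
  s * z0 = s2 * x0 + s1 * y0 /\ s *: z = s2 *: x + s1 *: y.
Proof.
move=> X Y Z XZ ZY XY S1 S2 T S.
pose u := s2 *: x + s1 *: y; pose w := s *: z + (-1) *: u.
pose w0 := s * z0 - (s2 * x0 + s1 * y0).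
have dw v : dotv w v = s * dotv z v - (s2 * dotv x v + s1 * dotv y v).
  by rewrite dotv_lin dotv_lin mulN1r.
have wX : w0 * x0 = dotv w x.
  apply/eqP; rewrite -subr_eq0 dw dotvv (dotvC z x) (dotvC y x); apply/eqP.
  have -> : sqnorm x = x0 ^+ 2 - 1 by lra.
  have -> : dotv x z = x0 * z0 - t1 by lra.
  have -> : dotv x y = x0 * y0 - t by lra.
  transitivity (s * t1 - s2 - s1 * t); first by rewrite /w0; ring.
  transitivity (s2 * (t1 ^+ 2 - 1 - s1 ^+ 2)); first by rewrite S T; ring.
  by rewrite S1; ring.
have wY : w0 * y0 = dotv w y.
  apply/eqP; rewrite -subr_eq0 dw dotvv; apply/eqP.
  have -> : sqnorm y = y0 ^+ 2 - 1 by lra.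
  have -> : dotv z y = z0 * y0 - t2 by lra.
  have -> : dotv x y = x0 * y0 - t by lra.
  transitivity (s * t2 - s1 - s2 * t); first by rewrite /w0; ring.
  transitivity (s1 * (t2 ^+ 2 - 1 - s2 ^+ 2)); first by rewrite S T; ring.
  by rewrite S2; ring.
have wZ : w0 * z0 = dotv w z.
  apply/eqP; rewrite -subr_eq0 dw dotvv (dotvC y z); apply/eqP.
  have -> : sqnorm z = z0 ^+ 2 - 1 by lra.
  have -> : dotv z y = z0 * y0 - t2 by lra.
  have -> : dotv x z = x0 * z0 - t1 by lra.
  transitivity (s - s2 * t1 - s1 * t2); first by rewrite /w0; ring.
  by rewrite S; ring.
have ww : w0 ^+ 2 = sqnorm w.
  rewrite -dotvv /w dotv_lin dotv_lin -/u -/w (dotvC z) (dotvC x) (dotvC y) -wX -wY -wZ.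
  by rewrite /w0; ring.
have cs := dotv_sq_le w x; rewrite -wX -ww exprMn in cs.
have w00 : w0 = 0.
  have xx : sqnorm x = x0 ^+ 2 - 1 by lra.
  rewrite xx in cs; apply/eqP; rewrite -sqrf_eq0; apply/eqP/le_anti.
  by rewrite sqr_ge0 andbT; nra.
split; first by move: w00; rewrite /w0; lra.
move: ww; rewrite w00 expr0n /= => /esym/sqnorm_eq0/eqP.
by rewrite /w scaleN1r subr_eq0 => /eqP.
Qed.

(** The coefficients are [sinh d(z,y) / sinh d(x,y)] and [sinh d(x,z) / sinh d(x,y)]. *)
Lemma hsegment_lift n (x y z : 'rV[R]_n) : pball x -> pball y -> hsegment x y z ->
  exists a b : R, [/\ 0 <= a, 0 <= b, lift0 z = a * lift0 x + b * lift0 y &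
    liftv z = a *: liftv x + b *: liftv y].
Proof.
move=> xb yb [zb]; rewrite /hdist -/(coshd x z) -/(coshd z y) -/(coshd x y) => E.
have [T S] := arcosh_add (coshd_ge1 xb zb) (coshd_ge1 zb yb) (coshd_ge1 xb yb) E.
set s1 := Num.sqrt (coshd x z ^+ 2 - 1) in T S.
set s2 := Num.sqrt (coshd z y ^+ 2 - 1) in T S.
set s := Num.sqrt _ in S.
have s10 : 0 <= s1 := sqrtr_ge0 _.
have s20 : 0 <= s2 := sqrtr_ge0 _.
have t1 := coshd_ge1 xb zb; have t2 := coshd_ge1 zb yb.
have S1 : s1 ^+ 2 = coshd x z ^+ 2 - 1 by rewrite sqr_sqrtr// subr_ge0 expr_ge1//; lra.
have S2 : s2 ^+ 2 = coshd z y ^+ 2 - 1 by rewrite sqr_sqrtr// subr_ge0 expr_ge1//; lra.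
(* If the endpoints coincide, the nonnegative terms of [S] vanish, so [z] is at distance zero from
   [x]. *)
have [s0|s0] := eqVneq s 0.
  have s1z : s1 = 0 by nra.
  exists 1, 0; rewrite ler01 lexx !mul1r !mul0r !addr0 scale1r scale0r addr0.
  suff -> : z = x by [].
  by apply/esym/coshd_eq1 => //; move: S1; rewrite s1z; nra.
have sp : 0 < s by rewrite lt_neqAle eq_sym s0 sqrtr_ge0.
have [C0 Cv] := lorentz_collinear (lift_hyperboloid xb) (lift_hyperboloid yb)
  (lift_hyperboloid zb) (esym (coshd_lift xb zb)) (esym (coshd_lift zb yb))
  (esym (coshd_lift xb yb)) S1 S2 T S.
exists (s2 / s), (s1 / s); split; rewrite ?divr_ge0 ?(ltW sp)//.
  by apply: (mulfI s0); rewrite C0; field.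
apply: (scalerI s0); rewrite Cv scalerDr !scalerA.
by rewrite ![s * (_ / s)]mulrC !divfK.
Qed.

(* In the Klein coordinates [2 x / (1 + |x|^2)], in which geodesics are straight,
   this set is the ellipsoid [\sum_i w i * y_i ^+ 2 <= 4]. *)
Lemma hconvex_ellipsoid n (w : 'I_n -> R) : (forall i, 0 <= w i) ->
  hconvex [set x | pball x /\ \sum_(i < n) w i * x ord0 i ^+ 2 <= (1 + sqnorm x) ^+ 2].
Proof.
move=> w0 x y [xb xK] [yb yK] z zs; have zb : pball z := zs.1.
split=> //.
pose N (v : 'rV[R]_n) := \sum_(i < n) w i * v ord0 i ^+ 2.
have NlE u : pball u -> N (liftv u) = (2 / (1 - sqnorm u)) ^+ 2 * N u.
  by move=> ub; rewrite /N mulr_sumr; apply: eq_bigr => i _; rewrite !mxE; ring.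
(* Multiplying by the squared conformal factor makes the condition homogeneous on the hyperboloid:
   it becomes a convex cone, stable under the nonnegative combinations that describe a segment. *)
have lE u : pball u -> (N u <= (1 + sqnorm u) ^+ 2) = (N (liftv u) <= (2 * lift0 u) ^+ 2).
  move=> ub; have d0 : 0 < 2 / (1 - sqnorm u) by rewrite divr_gt0 ?subr_gt0.
  rewrite NlE// (_ : (2 * lift0 u) ^+ 2 = (2 / (1 - sqnorm u)) ^+ 2 * (1 + sqnorm u) ^+ 2).
    by rewrite ler_pM2l// exprn_gt0.
  by rewrite -exprMn /lift0; congr (_ ^+ 2); ring.
rewrite -/(N z) lE//; move: xK yK; rewrite -/(N x) -/(N y) !lE// => xK yK.
have [a [b [a0 b0 Z0 Zv]]] := hsegment_lift xb yb zs.
have x0 := lift0_gt0 xb; have y0 := lift0_gt0 yb.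
set X := liftv x in xK Zv *; set Y := liftv y in yK Zv *.
pose B := \sum_(i < n) w i * (X ord0 i * Y ord0 i).
have Nlin c d : N (c *: X + d *: Y) = c ^+ 2 * N X + 2 * c * d * B + d ^+ 2 * N Y.
  by rewrite /N /B !mulr_sumr -!big_split /=; apply: eq_bigr => i _; rewrite !mxE; ring.
set p := lift0 x in xK Z0 x0 *; set q := lift0 y in yK Z0 y0 *.
(* Cauchy-Schwarz for the semidefinite form [N], read off from its value at [q X - p Y]; these
   weights turn both bounds into the same quantity [4 p^2 q^2]. *)
have Bpq : B <= 4 * p * q.
  have : 0 <= N (q *: X + (- p) *: Y).
    by apply: sumr_ge0 => i _; rewrite mulr_ge0 ?sqr_ge0.
  rewrite Nlin => h.
  have h1 : q ^+ 2 * N X <= q ^+ 2 * (2 * p) ^+ 2 by rewrite ler_wpM2l ?sqr_ge0.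
  have h2 : p ^+ 2 * N Y <= p ^+ 2 * (2 * q) ^+ 2 by rewrite ler_wpM2l ?sqr_ge0.
  have pq : 0 < p * q by rewrite mulr_gt0.
  rewrite -subr_ge0 -(pmulr_rge0 _ pq); nra.
rewrite Zv Nlin Z0.
have h1 : a ^+ 2 * N X <= a ^+ 2 * (2 * p) ^+ 2 by rewrite ler_wpM2l ?sqr_ge0.
have h2 : b ^+ 2 * N Y <= b ^+ 2 * (2 * q) ^+ 2 by rewrite ler_wpM2l ?sqr_ge0.
have h3 : (2 * a * b) * B <= (2 * a * b) * (4 * p * q) by rewrite ler_wpM2l ?mulr_ge0.
nra.
Qed.

End HyperbolicConvexity.

(** * The two bodies *)

Section Bodies.
Variables (R : realType) (n : nat).
Local Notation V := 'rV[R]_n.+1.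
Implicit Types x : V.

(* In Klein coordinates [y = (y0, y')] these three sets are
   [3 |y'|^2 + y0^2 <= 2], [5 |y'|^2 <= 3] and [|y'| <= |y0|]. *)
Definition bulge : set V :=
  [set x | 6 * sqnorm x - 4 * x ord0 ord0 ^+ 2 <= (1 + sqnorm x) ^+ 2].
Definition waist : set V :=
  [set x | 20 * (sqnorm x - x ord0 ord0 ^+ 2) <= 3 * (1 + sqnorm x) ^+ 2].
Definition double_cone : set V := [set x | sqnorm x <= 2 * x ord0 ord0 ^+ 2].

Definition Lbody (r : R) : set V := oball r `&` bulge.
Definition Kbody (r : R) : set V := oball r `&` (bulge `&` waist).

Lemma sqnorm_coord_le x i : x ord0 i ^+ 2 <= sqnorm x.
Proof.
rewrite /sqnorm (bigD1 i)//= lerDl.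
by apply: sumr_ge0 => j _; exact: sqr_ge0.
Qed.

Lemma sum_weights (a b : R) x :
  \sum_i (if i == ord0 then b else a) * x ord0 i ^+ 2 =
  a * sqnorm x + (b - a) * x ord0 ord0 ^+ 2.
Proof.
rewrite /sqnorm (bigD1 ord0)//= [in RHS](bigD1 ord0)//= mulrDr mulr_sumr.
rewrite (eq_bigr (fun i => a * x ord0 i ^+ 2)); first by ring.
by move=> i /negPf ->.
Qed.

(** * Convexity and symmetry of the bodies *)

Lemma hconvexI (A B : set V) : hconvex A -> hconvex B -> hconvex (A `&` B).
Proof.
move=> cA cB x y [xA xB] [yA yB] z zs.
by split; [exact: (cA x y)|exact: (cB x y)].
Qed.

Lemma oball_pball (r : R) : 0 < r < 1 -> oball r `<=` @pball R n.+1.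
Proof.
move=> /andP[r0 r1] x; rewrite /oball /pball /= => /le_lt_trans; apply.
by rewrite expr_lt1// ltW.
Qed.

(** In Klein coordinates this is the ball of radius [2 r / (1 + r^2)], an ellipsoid with constant
    weights. The two inequalities differ by the factor [1 - r^2 |x|^2], positive in the unit
    ball. *)
Lemma hconvex_oball (r : R) : 0 < r < 1 -> hconvex (oball r : set V).
Proof.
move=> r01; have /andP[r0 r1] := r01.
have b0 : 0 < r ^+ 2 by rewrite exprn_gt0.
have b1 : r ^+ 2 < 1 by rewrite expr_lt1// ltW.
have w0 : 0 <= (1 + r ^+ 2) ^+ 2 / r ^+ 2 by rewrite divr_ge0 ?sqr_ge0// ltW.
suff -> : (oball r : set V) = [set x | pball x /\
    \sum_i (1 + r ^+ 2) ^+ 2 / r ^+ 2 * x ord0 i ^+ 2 <= (1 + sqnorm x) ^+ 2].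
  exact: hconvex_ellipsoid.
have key x : pball x -> (sqnorm x <= r ^+ 2) =
    (\sum_i (1 + r ^+ 2) ^+ 2 / r ^+ 2 * x ord0 i ^+ 2 <= (1 + sqnorm x) ^+ 2).
  rewrite /pball /= -mulr_sumr -/(sqnorm x) => x1; have s0 := sqnorm_ge0 x.
  rewrite mulrAC ler_pdivrMr// -[RHS]subr_ge0.
  rewrite (_ : _ - _ = (r ^+ 2 - sqnorm x) * (1 - r ^+ 2 * sqnorm x)); last by ring.
  by rewrite pmulr_lge0 ?subr_ge0// subr_gt0; nra.
apply/seteqP; split=> x /=; last by move=> [xb]; rewrite /oball /= key.
by move=> xr; have xb := oball_pball r01 xr; split=> //; rewrite -key.
Qed.

Lemma hconvex_bulge : hconvex (@pball R n.+1 `&` bulge).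
Proof.
rewrite (_ : _ `&` _ = [set x | pball x /\
    \sum_i (if i == ord0 then 2 else 6) * x ord0 i ^+ 2 <= (1 + sqnorm x) ^+ 2]).
  by apply: (@hconvex_ellipsoid R n.+1 (fun i => if i == ord0 then 2 else 6)) => i; case: ifP.
apply/seteqP; split=> x [xb]; rewrite /bulge /= sum_weights => h; split=> //=; lra.
Qed.

Lemma hconvex_waist : hconvex (@pball R n.+1 `&` waist).
Proof.
rewrite (_ : _ `&` _ = [set x | pball x /\
    \sum_i (if i == ord0 then 0 else 20 / 3) * x ord0 i ^+ 2 <= (1 + sqnorm x) ^+ 2]).
  apply: (@hconvex_ellipsoid R n.+1 (fun i => if i == ord0 then 0 else 20 / 3)) => i.
  by case: ifP.
apply/seteqP; split=> x [xb]; rewrite /waist /= sum_weights => h; split=> //=; lra.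
Qed.

Lemma Lbody_convex r : 0 < r < 1 -> hconvex (Lbody r).
Proof.
move=> r01; rewrite (_ : Lbody r = oball r `&` (@pball R n.+1 `&` bulge)).
  by apply: hconvexI; [exact: hconvex_oball|exact: hconvex_bulge].
apply/seteqP; split=> x; last by move=> [? []].
by move=> [xr ?]; split=> //; split=> //; exact: oball_pball xr.
Qed.

Lemma Kbody_convex r : 0 < r < 1 -> hconvex (Kbody r).
Proof.
move=> r01; rewrite (_ : Kbody r = Lbody r `&` (@pball R n.+1 `&` waist)).
  by apply: hconvexI; [exact: Lbody_convex|exact: hconvex_waist].
apply/seteqP; split=> x; last by move=> [[? ?] []].
by move=> [xr [? ?]]; split=> //; split=> //; exact: oball_pball xr.
Qed.

Lemma sqnormN x : sqnorm (- x) = sqnorm x.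
Proof. by rewrite -scaleN1r sqnormZ sqrrN expr1n mul1r. Qed.

Lemma csymP (A : set V) : (forall x, A x -> A (- x)) -> csym A.
Proof.
move=> AN; apply/seteqP; split=> [x Ax|_ [x Ax <-]]; last exact: AN.
by exists (- x); rewrite ?opprK//; exact: AN.
Qed.

Lemma Lbody_csym r : csym (Lbody r).
Proof. by apply: csymP => x; rewrite /Lbody /oball /bulge /= sqnormN mxE sqrrN. Qed.

Lemma Kbody_csym r : csym (Kbody r).
Proof. by apply: csymP => x; rewrite /Kbody /oball /bulge /waist /= sqnormN mxE sqrrN. Qed.

(** * Compactness and non-empty interior of the bodies *)

Lemma continuous_sqnorm : continuous (@sqnorm R n.+1).
Proof.
move=> x; rewrite /sqnorm.
apply: (@cvg_big _ _ _ _ _ add_continuous _ (nbhs x)) => i _.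
by apply: cvgM; exact: coord_continuous.
Qed.

Lemma continuous_coord2 : continuous (fun x : V => x ord0 ord0 ^+ 2).
Proof.
move=> x; have c := @coord_continuous R 1 n.+1 ord0 ord0 x.
exact: (cvgM c c).
Qed.

Lemma continuous_funD (f g : V -> R) : continuous f -> continuous g ->
  continuous (fun x => f x + g x).
Proof. by move=> cf cg x; have := cvgD (cf x) (cg x); exact. Qed.

Lemma continuous_funB (f g : V -> R) : continuous f -> continuous g ->
  continuous (fun x => f x - g x).
Proof. by move=> cf cg x; have := cvgB (cf x) (cg x); exact. Qed.

Lemma continuous_funM (f g : V -> R) : continuous f -> continuous g ->
  continuous (fun x => f x * g x).
Proof. by move=> cf cg x; have := cvgM (cf x) (cg x); exact. Qed.

Lemma closed_fun_le (f g : V -> R) : continuous f -> continuous g ->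
  closed [set x | f x <= g x].
Proof.
move=> cf cg.
rewrite (_ : [set x | _] = (fun x => f x - g x) @^-1` [set y | y <= 0]).
  apply: closed_comp; last exact: closed_le.
  by move=> x _; exact: continuous_funB.
by apply/seteqP; split=> x /=; rewrite subr_le0.
Qed.

Lemma body_compact (r : R) (A : set V) : 0 < r < 1 -> closed A -> compact (oball r `&` A).
Proof.
move=> r01 cA; apply: bounded_closed_compact.
  exists 1; split; first exact: num_real.
  move=> M M1 x [xr _].
  have xb := oball_pball r01 xr.
  apply: (le_trans _ (ltW M1)).
  rewrite /= /Num.norm /= mx_normrE; apply/bigmax_leP; split=> // -[i j] _ /=.
  rewrite (ord1 i) -[leRHS](expr1n _ 2) -(@ler_pXn2r _ 2)// ?nnegrE// expr1n real_normK ?num_real//.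
  by apply: (le_trans (sqnorm_coord_le x j)); rewrite expr1n ltW.
apply: closedI => //; apply: closed_fun_le; first exact: continuous_sqnorm.
exact: cst_continuous.
Qed.

Lemma closed_bulge : closed bulge.
Proof.
have cs := continuous_sqnorm; have cc := continuous_coord2.
have c a : continuous (fun _ : V => a : R) by exact: cst_continuous.
apply: closed_fun_le; last by do ![apply: continuous_funM|apply: continuous_funD].
by apply: continuous_funB; apply: continuous_funM.
Qed.

Lemma closed_waist : closed waist.
Proof.
have cs := continuous_sqnorm; have cc := continuous_coord2.
have c a : continuous (fun _ : V => a : R) by exact: cst_continuous.
apply: closed_fun_le; first by apply: continuous_funM => //; apply: continuous_funB.
by do ![apply: continuous_funM|apply: continuous_funD].
Qed.

Lemma body_interior (A : set V) : (forall x, sqnorm x < 1 / 16 -> A x) -> interior A !=set0.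
Proof.
move=> h; exists 0; rewrite /interior /=.
have : \forall x \near (0 : V), sqnorm x < 1 / 16.
  apply: (cvgr_lt _ (@continuous_sqnorm 0)).
  rewrite /sqnorm big1 => [|i _]; last by rewrite mxE expr0n.
  by lra.
exact: filterS.
Qed.

Lemma small_in_bodies x (r : R) : 1 / 2 <= r -> sqnorm x < 1 / 16 ->
  [/\ oball r x, bulge x & waist x].
Proof.
move=> r2 xs; have s0 := sqnorm_ge0 x; have q0 := sqr_ge0 (x ord0 ord0).
by split; rewrite /oball /bulge /waist /=; nra.
Qed.

Lemma Lbody_body r : 1 / 2 <= r < 1 -> hbody (Lbody r).
Proof.
move=> /andP[r2 r1]; have r01 : 0 < r < 1 by apply/andP; split=> //; lra.
split; first by move=> x [+ _]; exact: oball_pball.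
split; first exact: body_compact closed_bulge.
by apply: body_interior => x /(small_in_bodies r2)[].
Qed.

Lemma Kbody_body r : 1 / 2 <= r < 1 -> hbody (Kbody r).
Proof.
move=> /andP[r2 r1]; have r01 : 0 < r < 1 by apply/andP; split=> //; lra.
split; first by move=> x [+ _]; exact: oball_pball.
split.
  by apply: body_compact => //; apply: closedI; [exact: closed_bulge|exact: closed_waist].
by apply: body_interior => x /(small_in_bodies r2)[].
Qed.

(** Klein coordinates satisfy [|y| <= 1], which is [(1 - |x|^2)^2 >= 0]; on the cone
    [|y'|^2 <= 1/2], hence [3 |y'|^2 + y0^2 <= 2] and [5 |y'|^2 <= 3]. *)
Lemma double_cone_sub x : double_cone x -> bulge x /\ waist x.
Proof.
have s0 := sqnorm_ge0 x; have d0 := sqr_ge0 (1 - sqnorm x).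
rewrite /double_cone /bulge /waist /= => h.
by split; nra.
Qed.

(** In Klein coordinates [|y'|^2 > 3/5] and the bulge give [|y|^2 < 4/5]. The collar thus stays away
    from infinity, with a bound independent of the radius. *)
Lemma collar_bounded x : pball x -> bulge x -> ~ waist x -> sqnorm x <= 2 / 5.
Proof.
have s0 := sqnorm_ge0 x.
rewrite /pball /bulge /waist /= => xb h /negP; rewrite -ltNge => h'.
nra.
Qed.

(** The equatorial point [u / 2] has Klein radius [4/5], and [16/25] lies strictly between the
    equatorial bounds [3/5] of the waist and [2/3] of the bulge; this leaves room for a perturbation
    of size [1/200]. *)
Lemma collar_contains (u e : V) : sqnorm u = 1 -> u ord0 ord0 = 0 ->
  sqnorm e <= (1 / 200) ^+ 2 ->
  let x := 2^-1 *: u + 1 *: e in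
  [/\ sqnorm x <= 1 / 2, bulge x & ~ waist x].
Proof.
move=> u1 u0 e1 x.
have e0 := sqnorm_ge0 e.
have q0 : x ord0 ord0 ^+ 2 <= (1 / 200) ^+ 2.
  rewrite !mxE u0 mulr0 add0r mul1r; exact: le_trans (sqnorm_coord_le e ord0) e1.
have t := dotv_sq_le u e; rewrite u1 mul1r in t.
have {t} [t1 t2] : - (1 / 200) <= dotv u e /\ dotv u e <= 1 / 200 by split; nra.
have := sqnorm_lin 2^-1 1 u e; rewrite -/x u1 => s.
have s1 : 49 / 200 <= sqnorm x by rewrite s; lra.
have s2 : sqnorm x <= 13 / 50 by rewrite s; lra.
have qq := sqr_ge0 (x ord0 ord0).
split; first by lra.
  by rewrite /bulge /=; nra.
by rewrite /waist /=; apply/negP; rewrite -ltNge; nra.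
Qed.

End Bodies.

(** * Volumes of sections *)

Section FrameVolume.
Variables (R : realType) (n N : nat) (U : 'M[R]_(n, N)).
Hypothesis UU : U *m U^T = 1%:M.

Lemma sqnorm_frame (y : 'rV[R]_n) : sqnorm (y *m U) = sqnorm y.
Proof.
have E k (x : 'rV[R]_k) : sqnorm x = (x *m x^T) ord0 ord0.
  by rewrite !mxE; apply: eq_bigr => i _; rewrite mxE expr2.
by rewrite !E trmx_mul mulmxA -(mulmxA y) UU mulmx1.
Qed.

(** Treats both volumes at once: [hvol_sec] for [k = n = N - 1], and [hvol] for the identity frame
    with [k = n = N]. *)
Definition frame_vol (k : nat) (A : set 'rV[R]_N) : \bar R :=
  iint (fun y : 'rV[R]_n => ((\1_(A `&` @pball R N) (y *m U) : R) * hdens k y)%:E).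

Lemma hdens_ge0 k (y : 'rV[R]_n) : sqnorm y < 1 -> 0 <= hdens k y.
Proof. by move=> y1; rewrite exprn_ge0// divr_ge0// subr_ge0 ltW. Qed.

(** Outside the ball the density is negative for odd [k], but the indicator vanishes there because
    the frame preserves norms. *)
Lemma frame_dens_ge0 k (A : set 'rV[R]_N) (y : 'rV[R]_n) :
  0 <= (\1_(A `&` @pball R N) (y *m U) : R) * hdens k y.
Proof.
rewrite indicE; have [/set_mem[_]|_] := boolP (_ \in _); last by rewrite mul0r.
by rewrite /pball /= sqnorm_frame mul1r => /hdens_ge0.
Qed.

Lemma rv_mset_pball : rv_mset (@pball R N).
Proof.
rewrite (_ : pball (n:=N) = [set: 'rV[R]_N] `\` [set x | 1 <= sqnorm x]).
  apply: rv_msetD; first by rewrite /rv_mset indicT.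
  by apply: rv_mset_le; [exact: rv_measurable_cst|exact: rv_measurable_sqnorm].
apply/seteqP; split=> x; rewrite /pball /= => h; first by split=> //; apply/negP; rewrite -ltNge.
by case: h => _ /negP; rewrite -ltNge.
Qed.

Lemma rv_measurable_frame_dens k (A : set 'rV[R]_N) : rv_mset A ->
  rv_measurable (fun y : 'rV[R]_n => ((\1_(A `&` @pball R N) (y *m U) : R) * hdens k y)%:E).
Proof.
move=> mA; apply: rv_measurable_EFin; apply: rv_measurableM; last exact: rv_measurable_hdens.
by apply: rv_measurable_mulmx; apply: rv_msetI => //; exact: rv_mset_pball.
Qed.

(** Pointwise, disjointness gives [1_A + 1_B <= 1 <= 1_C + 1_D] on the union of [A] and [B]. The
    additive form avoids subtracting possibly infinite volumes. *)
Lemma frame_vol_le4 k (A B C D : set 'rV[R]_N) :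
  rv_mset A -> rv_mset B -> rv_mset C -> rv_mset D ->
  A `<=` C `|` D -> B `<=` C `|` D -> A `&` B = set0 ->
  (frame_vol k A + frame_vol k B <= frame_vol k C + frame_vol k D)%E.
Proof.
move=> mA mB mC mD AS BS AB.
have g0 E y : (0 <= ((\1_(E `&` @pball R N) (y *m U) : R) * hdens k y)%:E)%E.
  by rewrite lee_fin frame_dens_ge0.
have gm := rv_measurable_frame_dens k.
rewrite /frame_vol -!iintD//; try exact: gm.
apply: le_iint => [y|y||]; first by rewrite adde_ge0.
- rewrite -!EFinD lee_fin -!mulrDl !indicE !in_setI.
  have [yb|] := boolP (_ \in @pball R N); last by rewrite !andbF.
  rewrite !andbT; apply: ler_wpM2r.
    by apply: hdens_ge0; rewrite -sqnorm_frame; exact: set_mem yb.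
  set x := y *m U; rewrite -!natrD ler_nat.
  have AU : (x \in A) ==> (x \in C) || (x \in D).
    by apply/implyP; rewrite -in_setU !inE => /AS.
  have BU : (x \in B) ==> (x \in C) || (x \in D).
    by apply/implyP; rewrite -in_setU !inE => /BS.
  have : ~~ ((x \in A) && (x \in B)) by rewrite -in_setI AB in_set0.
  by move: AU BU; do 4 case: (x \in _).
- by move=> d' S x mx; apply: emeasurable_funD; [exact: gm mA _ _ _ mx|exact: gm mB _ _ _ mx].
- by move=> d' S x mx; apply: emeasurable_funD; [exact: gm mC _ _ _ mx|exact: gm mD _ _ _ mx].
Qed.

Lemma frame_vol_le k (A : set 'rV[R]_N) (B : set 'rV[R]_n) (c : R) :
  rv_mset A -> rv_mset B -> 0 <= c ->
  (forall y, pball y -> A (y *m U) -> B y /\ hdens k y <= c) ->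
  (frame_vol k A <= c%:E * vol B)%E.
Proof.
move=> mA mB c0 h; rewrite /vol -iintZl//; last exact: rv_measurable_EFin.
apply: le_iint => [y|y||].
- by rewrite lee_fin frame_dens_ge0.
- rewrite -EFinM lee_fin indicE; have [/set_mem[Ay yb]|_] := boolP (_ \in _).
    have yb' : pball y by move: yb; rewrite /pball /= sqnorm_frame.
    by have [By le] := h y yb' Ay; rewrite indicE mem_set// mul1r mulr1.
  by rewrite mul0r mulr_ge0// indicE.
- exact: rv_measurable_frame_dens.
- exact: (rv_measurable_EFin (rv_measurableM (rv_measurable_cst c) mB)).
Qed.

Lemma frame_vol_ge k (A : set 'rV[R]_N) (B : set 'rV[R]_n) (c : R) :
  rv_mset A -> rv_mset B -> 0 <= c ->
  (forall y, B y -> [/\ pball y, A (y *m U) & c <= hdens k y]) ->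
  (c%:E * vol B <= frame_vol k A)%E.
Proof.
move=> mA mB c0 h; rewrite /vol -iintZl//; last exact: rv_measurable_EFin.
apply: le_iint => [y|y||].
- by rewrite -EFinM lee_fin mulr_ge0// indicE.
- rewrite -EFinM lee_fin [leLHS](_ : _ = if y \in B then c else 0); last first.
    by rewrite indicE; case: ifP; rewrite ?mulr1 ?mulr0.
  case: ifP => [/set_mem By|_]; last exact: frame_dens_ge0.
  have [yb Ay le] := h y By.
  by rewrite indicE mem_set ?mul1r//; split=> //; rewrite /pball /= sqnorm_frame.
- exact: (rv_measurable_EFin (rv_measurableM (rv_measurable_cst c) mB)).
- exact: rv_measurable_frame_dens.
Qed.

End FrameVolume.

(** * Estimates *)

Section Estimates.
Variable R : realType.

Lemma hdens_le n k (b : R) (x : 'rV[R]_n) : sqnorm x <= b -> b < 1 ->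
  hdens k x <= (2 / (1 - b)) ^+ k.
Proof.
move=> xb b1; apply: lerXn2r; rewrite ?nnegrE ?divr_ge0 ?subr_ge0 ?(ltW b1)//.
  exact: le_trans (ltW b1).
by rewrite ler_pM2l// lef_pV2 ?posrE ?subr_gt0 ?lerD2l ?lerN2//; exact: le_lt_trans b1.
Qed.

Lemma hdens_ge n k (b : R) (x : 'rV[R]_n) : b <= sqnorm x -> sqnorm x < 1 ->
  (2 / (1 - b)) ^+ k <= hdens k x.
Proof.
move=> bx x1; apply: lerXn2r; rewrite ?nnegrE ?divr_ge0 ?subr_ge0 ?(ltW x1)//.
  exact: le_trans (ltW x1).
by rewrite ler_pM2l// lef_pV2 ?posrE ?subr_gt0 ?lerD2l ?lerN2//; exact: le_lt_trans x1.
Qed.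

Lemma exprB_le k (r r' : R) : 0 <= r -> r <= r' -> r' <= 1 ->
  r' ^+ k - r ^+ k <= k%:R * (r' - r).
Proof.
move=> r0 rr r1; elim: k => [|k IH]; first by rewrite !expr0 subrr mul0r.
have r'0 : 0 <= r' := le_trans r0 rr.
have a1 : r' ^+ k <= 1 by rewrite exprn_ile1.
have a2 : r ^+ k <= 1 by rewrite exprn_ile1// (le_trans rr).
have a3 : 0 <= r ^+ k by rewrite exprn_ge0.
have a4 : r ^+ k <= r' ^+ k by rewrite lerXn2r.
rewrite !exprS -natr1; nra.
Qed.

Lemma exprB_ge k (r r' : R) : 0 <= r -> r <= r' ->
  (r' - r) * r ^+ k <= r' ^+ k.+1 - r ^+ k.+1.
Proof.
move=> r0 rr; have r'0 : 0 <= r' := le_trans r0 rr.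
rewrite mulrBl -exprS lerD2r exprS ler_wpM2l// lerXn2r//.
Qed.

(* With [r = 1 - e] and [r' - r] of order [e ^ k], the shell between the two radii has
   bounded hyperbolic [k]-volume but hyperbolic [k+1]-volume of order [1 / e]. *)
Lemma thin_shell k (v E kappa M : R) : (0 < k)%N -> 0 < v -> 0 <= E -> 0 < kappa -> 0 <= M ->
  exists r r' : R, [/\ 9 / 10 <= r, r < r', r' < 1,
    (2 / (1 - r' ^+ 2)) ^+ k * ((r' ^+ k - r ^+ k) * E) <= v &
    M < (2 / (1 - r ^+ 2)) ^+ k.+1 * ((r' ^+ k.+1 - r ^+ k.+1) * kappa)].
Proof.
move=> k0 v0 E0 K0 M0.
have k1 : 1 <= k%:R :> R by rewrite ler1n.
pose F := 4 ^+ k * k%:R * E.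
have F0 : 0 <= F by rewrite !mulr_ge0// exprn_ge0.
(* The summand [2 * v] keeps [c <= 1/2] even when [F = 0], while [F * c <= v] is the bound wanted
   for the [k]-volume. *)
pose c := v / (F + 2 * v).
have Fv : 0 < F + 2 * v by lra.
have c0 : 0 < c by rewrite divr_gt0.
have c1 : c <= 1 / 2 by rewrite ler_pdivrMr//; lra.
have cF : F * c <= v by rewrite mulrA ler_pdivrMr//; nra.
pose q := c * kappa * 2^-1 ^+ k.
have q0 : 0 < q by rewrite !mulr_gt0// ?exprn_gt0// ?invr_gt0.
(* The lower bound for the larger volume will be [q / e = M + 1 + 10 q], which exceeds [M]; the term
   [10 q] forces [e <= 1/10]. *)
pose e := q / (M + 1 + 10 * q).
have D0 : 0 < M + 1 + 10 * q by lra.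
have e0 : 0 < e by rewrite divr_gt0.
have e1 : e <= 1 / 10 by rewrite ler_pdivrMr//; lra.
pose d := c * e ^+ k.
have ek0 : 0 < e ^+ k by rewrite exprn_gt0.
have d0 : 0 < d by rewrite mulr_gt0.
(* This leaves [1 - r' >= e / 2], so the conformal factor at [r'] is at most [4 / e]; its [k]-th
   power is cancelled by the [e ^+ k] in [d]. *)
have d1 : d <= e / 2.
  have : e ^+ k <= e by rewrite -{2}(expr1 e); apply: ler_wiXn2l => //; lra.
  by rewrite /d; nra.
have r0 : 0 <= 1 - e by lra.
have rr : 1 - e <= 1 - e + d by lra.
exists (1 - e), (1 - e + d); split; [lra|lra|lra| |].
  apply: le_trans cF; have -> : F * c = (4 / e) ^+ k * ((k%:R * d) * E).
    by rewrite expr_div_n /d /F; field; rewrite gt_eqF.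
  have p1 : 0 < 1 - (1 - e + d) ^+ 2 by nra.
  apply: ler_pM.
  - by rewrite exprn_ge0// divr_ge0// ltW.
  - by rewrite mulr_ge0// subr_ge0 lerXn2r ?nnegrE//; lra.
  - have h : 2 / (1 - (1 - e + d) ^+ 2) <= 4 / e.
      by rewrite ler_pdivrMr// mulrAC ler_pdivlMr//; nra.
    by rewrite lerXn2r// nnegrE divr_ge0// ltW.
  - rewrite ler_wpM2r//; apply: le_trans (exprB_le _ r0 rr _) _; first by lra.
    by rewrite ler_wpM2l//; lra.
have p1 : 0 < 1 - (1 - e) ^+ 2 by nra.
apply: (@lt_le_trans _ _ (e^-1 ^+ k.+1 * ((d * 2^-1 ^+ k) * kappa))).
  have -> : e^-1 ^+ k.+1 * ((d * 2^-1 ^+ k) * kappa) = q / e.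
    by rewrite /d /q exprVn exprS; field; rewrite !gt_eqF.
  have -> : q / e = M + 1 + 10 * q by rewrite /e; field; rewrite !gt_eqF.
  by lra.
apply: ler_pM.
- by rewrite exprn_ge0// invr_ge0 ltW.
- by rewrite !mulr_ge0// ?exprn_ge0// ?invr_ge0// ltW.
- have h : e^-1 <= 2 / (1 - (1 - e) ^+ 2).
    by rewrite ler_pdivlMr// mulrC ler_pdivrMr//; nra.
  by rewrite lerXn2r// nnegrE ?invr_ge0 ?divr_ge0// ltW.
- rewrite ler_pM2r//; apply: le_trans (exprB_ge k r0 rr).
  rewrite addrAC subrr add0r ler_wpM2l ?(ltW d0)// lerXn2r// ?nnegrE; lra.
Qed.

(** A small cube about the point at height [1/2] on the polar axis fits inside. Its half-side, of
    order [1 / n], keeps the sum of the equatorial squares below [1/8], while the polar coordinate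
    stays between [3/8] and [5/8]. *)
Lemma vol_cone_gt0 n : 0 < fine (vol (@double_cone R n `&` @oball R n.+1 1)).
Proof.
pose t : R := 1 / (4 * (n.+2)%:R).
have n1 : 2 <= (n.+2)%:R :> R by rewrite ler_nat.
have t0 : 0 < t by rewrite divr_gt0// mulr_gt0//; lra.
have t1 : t <= 1 / 8 by rewrite ler_pdivrMr ?mulr_gt0//; lra.
have mC : rv_mset (@double_cone R n).
  apply: rv_mset_le; first exact: rv_measurable_sqnorm.
  by apply: rv_measurableM; [exact: rv_measurable_cst|apply: rv_measurableX; exact: rv_measurable_coord].
pose w : 'rV[R]_n.+1 := \row_i (if i == ord0 then 2^-1 else 0).
have := @le_vol R _ (cube w t) (double_cone (R:=R) (n:=n) `&` @oball R n.+1 1).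
rewrite /vol iint_cube ?(ltW t0)// -/(vol _) -(fineK (vol_cone_oball1_fin mC)) lee_fin => h.
apply: (@lt_le_trans _ _ ((2 * t) ^+ n.+1)); first by rewrite exprn_gt0// mulr_gt0.
apply: h; first exact: rv_mset_cube.
  by apply: rv_msetI => //; exact: rv_mset_oball.
move=> x xw.
have x0 : 3 / 8 <= x ord0 ord0 <= 5 / 8.
  have := xw ord0; rewrite mxE eqxx ler_norml => /andP[? ?]; apply/andP; split; lra.
have s : sqnorm x <= x ord0 ord0 ^+ 2 + 1 / 8.
  rewrite /sqnorm (bigD1 ord0)//= lerD2l.
  apply: (@le_trans _ _ (\sum_(i < n.+1 | i != ord0) t ^+ 2)).
    apply: ler_sum => i i0; have := xw i; rewrite mxE (negPf i0) subr0 => xi.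
    by rewrite -(real_normK (num_real _)) lerXn2r// nnegrE// ltW.
  apply: (@le_trans _ _ (\sum_(i < n.+1) t ^+ 2)).
    by rewrite [leRHS](bigD1 ord0)//= lerDr sqr_ge0.
  rewrite sumr_const card_ord -[_ *+ n.+1]mulr_natl.
  have n2 : (n.+1)%:R <= (n.+2)%:R :> R by rewrite ler_nat.
  have -> : (n.+1)%:R * t ^+ 2 = t * ((n.+1)%:R / (n.+2)%:R / 4).
    by rewrite /t; field; rewrite gt_eqF//; lra.
  have : (n.+1)%:R / (n.+2)%:R <= 1 :> R by rewrite ler_pdivrMr ?mul1r//; lra.
  have : 0 <= (n.+1)%:R / (n.+2)%:R :> R by rewrite divr_ge0.
  by set z := _ / _; nra.
move/andP: x0 => [xa xb].
by split; rewrite /double_cone /oball /=; nra.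
Qed.

(** A linear form on a space of dimension at least two has a nonzero kernel vector, which is then
    normalized. This is where [n - 1 >= 2] enters. *)
Lemma frame_perp_pole m (U : 'M[R]_(m.+2, m.+3)) :
  exists w : 'rV[R]_m.+2, sqnorm w = 1 /\ (w *m U) ord0 ord0 = 0.
Proof.
pose A := col ord0 U; pose w := nz_row (kermx A).
have w0 : w != 0.
  rewrite nz_row_eq0 kermx_eq0 /row_free neq_ltn.
  by rewrite (leq_ltn_trans (rank_leq_col A)).
have wA : (w *m U) ord0 ord0 = 0.
  have /sub_kermxP : (w <= kermx A)%MS by exact: nz_row_sub.
  move=> /matrixP /(_ ord0 ord0); rewrite !mxE => E; rewrite -[RHS]E.
  by apply: eq_bigr => i _; rewrite mxE.
have s0 : 0 < sqnorm w.
  rewrite lt_neqAle sqnorm_ge0 andbT eq_sym; apply: contra_neq w0.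
  exact: sqnorm_eq0.
exists ((Num.sqrt (sqnorm w))^-1 *: w); split.
  by rewrite sqnormZ exprVn sqr_sqrtr ?(ltW s0)// mulVf// gt_eqF.
by rewrite -scalemxAl mxE wA mulr0.
Qed.

(** The cube is centred at half of a unit equatorial vector of the section, and its half-side keeps
    it within Euclidean distance [1/200] of the centre. This size depends on neither [U] nor [r], so
    the loss is uniform. *)
Lemma collar_section m (U : 'M[R]_(m.+2, m.+3)) (r : R) : U *m U^T = 1%:M -> 9 / 10 <= r ->
  exists w : 'rV[R]_m.+2, forall y, cube w (1 / (200 * (m.+2)%:R)) y ->
    (Lbody r `\` waist (n := m.+2)) (y *m U) /\ sqnorm y <= 1 / 2.
Proof.
move=> UU r1; have [w [w1 wU]] := frame_perp_pole U.
exists (2^-1 *: w) => y yw.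
pose e := y - 2^-1 *: w.
have e1 : sqnorm (e *m U) <= (1 / 200) ^+ 2.
  rewrite sqnorm_frame//.
  apply: (@le_trans _ _ (\sum_(i < m.+2) (1 / (200 * (m.+2)%:R)) ^+ 2)).
    apply: ler_sum => i _; rewrite !mxE -(real_normK (num_real _)) lerXn2r ?nnegrE//.
    by have := yw i; rewrite !mxE.
  rewrite sumr_const card_ord -[_ *+ m.+2]mulr_natl.
  have n1 : 1 <= (m.+2)%:R :> R by rewrite ler1n.
  have -> : (m.+2)%:R * (1 / (200 * (m.+2)%:R)) ^+ 2 = (1 / 200) ^+ 2 / (m.+2)%:R :> R.
    by field; rewrite gt_eqF//; lra.
  rewrite ler_pdivrMr; last by lra.
  by rewrite ler_peMr// sqr_ge0.
have yE : y *m U = 2^-1 *: (w *m U) + 1 *: (e *m U).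
  by rewrite scale1r mulmxBl scalemxAl addrC subrK.
have := collar_contains (etrans (sqnorm_frame UU w) w1) wU e1.
rewrite /= -yE => -[s b nw].
by split; [split=> //; split=> //; rewrite /oball /=; nra|rewrite -(sqnorm_frame UU)].
Qed.

End Estimates.

(** * Comparison of the sections and volumes of the two bodies *)

Section Comparison.
Variable R : realType.

Lemma rv_mset_bulge n : rv_mset (@bulge R n).
Proof.
apply: rv_mset_le.
  apply: (rv_measurableD (f := fun x => 6 * sqnorm x) (g := fun x => - (4 * x ord0 ord0 ^+ 2))).
    by apply: rv_measurableM; [exact: rv_measurable_cst|exact: rv_measurable_sqnorm].
  move=> d S x mx; apply: measurable_funN.
  exact: (rv_measurableM (rv_measurable_cst 4) (rv_measurableX 2 (rv_measurable_coord ord0))).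
apply: (rv_measurableX 2); apply: rv_measurableD; first exact: rv_measurable_cst.
exact: rv_measurable_sqnorm.
Qed.

Lemma rv_mset_waist n : rv_mset (@waist R n).
Proof.
apply: rv_mset_le; (apply: rv_measurableM; first exact: rv_measurable_cst).
  apply: (rv_measurableD (f := @sqnorm R n.+1) (g := fun x => - (x ord0 ord0 ^+ 2))).
    exact: rv_measurable_sqnorm.
  move=> d S x mx; apply: measurable_funN.
  exact: (rv_measurableX 2 (rv_measurable_coord ord0)).
apply: (rv_measurableX 2); apply: rv_measurableD; first exact: rv_measurable_cst.
exact: rv_measurable_sqnorm.
Qed.

Lemma rv_mset_double_cone n : rv_mset (@double_cone R n).
Proof.
apply: rv_mset_le; first exact: rv_measurable_sqnorm.
by apply: rv_measurableM; [exact: rv_measurable_cst|apply: rv_measurableX; exact: rv_measurable_coord].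
Qed.

Lemma double_coneZ n (c : R) (x : 'rV[R]_n.+1) : 0 < c -> double_cone (c *: x) <-> double_cone x.
Proof.
move=> c0; rewrite /double_cone /= sqnormZ mxE exprMn mulrCA ler_pM2l//.
by rewrite exprn_gt0.
Qed.

Lemma rv_mset_shell n (r r' : R) : rv_mset (@oball R n r' `\` @oball R n r).
Proof. by apply: rv_msetD; exact: rv_mset_oball. Qed.

Lemma hvolE n (A : set 'rV[R]_n) : hvol A = frame_vol 1%:M n A.
Proof. by apply: eq_iint => x; rewrite mulmx1. Qed.

Section Pair.
Variables (m : nat) (r r' : R).
Hypotheses (r910 : 9 / 10 <= r) (rr' : r < r') (r'1 : r' < 1).

Local Notation L := (@Lbody R m.+2 r).
Local Notation K := (@Kbody R m.+2 r').
Local Notation collar := (L `\` @waist R m.+2).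
Local Notation shell := (@oball R m.+3 r' `\` @oball R m.+3 r).
Local Notation caps := (@double_cone R m.+2 `&` shell).

Let mL : rv_mset L.
Proof. by apply: rv_msetI; [exact: rv_mset_oball|exact: rv_mset_bulge]. Qed.

Let mK : rv_mset K.
Proof.
apply: rv_msetI; first exact: rv_mset_oball.
by apply: rv_msetI; [exact: rv_mset_bulge|exact: rv_mset_waist].
Qed.

Let mcollar : rv_mset collar.
Proof. by apply: rv_msetD => //; exact: rv_mset_waist. Qed.

Let mcaps : rv_mset caps.
Proof. by apply: rv_msetI; [exact: rv_mset_double_cone|exact: rv_mset_shell]. Qed.

Let r0 : 0 < r. Proof. by apply: lt_le_trans r910; lra. Qed.
Let r1 : r < 1. Proof. exact: lt_trans rr' r'1. Qed.
Let r'0 : 0 < r'. Proof. exact: lt_trans r0 rr'. Qed.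
Let r2lt1 : r ^+ 2 < 1. Proof. by rewrite expr_lt1// ltW. Qed.
Let r'2lt1 : r' ^+ 2 < 1. Proof. by rewrite expr_lt1// ltW. Qed.

Lemma oball_le n : @oball R n r `<=` @oball R n r'.
Proof. by move=> x; rewrite /oball /= => /le_trans; apply; rewrite lerXn2r ?nnegrE// ltW.
Qed.

(** [K] and the collar are disjoint and both lie in the union of [L] and the shell. In the section
    the shell has volume at most [v] and the collar at least [v]. *)
Lemma section_le (U : 'M[R]_(m.+2, m.+3)) : U *m U^T = 1%:M ->
  (2 / (1 - r' ^+ 2)) ^+ m.+2 *
    ((r' ^+ m.+2 - r ^+ m.+2) * fine (vol (setT `&` @oball R m.+2 1))) <=
    (2 * (1 / (200 * (m.+2)%:R))) ^+ m.+2 ->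
  (@hvol_sec R m.+3 U K <= @hvol_sec R m.+3 U L)%E.
Proof.
move=> UU; set t := 1 / (200 * _); set v := ((2 * t) ^+ m.+2) => small.
have cmp : (frame_vol U m.+2 K + frame_vol U m.+2 collar <=
            frame_vol U m.+2 L + frame_vol U m.+2 shell)%E.
  apply: frame_vol_le4 => //; first exact: rv_mset_shell.
  - move=> x [xr' [xb _]]; have [xr|xr] := pselect (oball r x); first by left.
    by right.
  - by move=> x [xL _]; left.
  - by apply/seteqP; split=> // x [[_ [_ xw]] [_]].
have up : (frame_vol U m.+2 shell <= v%:E)%E.
  apply: (@le_trans _ _ (((2 / (1 - r' ^+ 2)) ^+ m.+2)%:E *
     vol (setT `&` (@oball R m.+2 r' `\` @oball R m.+2 r)))%E).
    apply: frame_vol_le => //; first exact: rv_mset_shell.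
    - by apply: rv_msetI; [rewrite /rv_mset indicT|exact: rv_mset_shell].
    - by rewrite exprn_ge0// divr_ge0// subr_ge0 ltW.
    - move=> y yb; rewrite /oball /= sqnorm_frame// => -[y1 y2].
      by split=> //; exact: hdens_le.
  rewrite vol_cone_shell ?(ltW rr')//; last by rewrite /rv_mset indicT.
have lo : (v%:E <= frame_vol U m.+2 collar)%E.
  have [w hw] := collar_section UU r910.
  have t0 : 0 <= t by rewrite divr_ge0// mulr_ge0.
  (* The hyperbolic density is at least [1] in the ball, so the Euclidean volume of the cube is a
     lower bound. *)
  rewrite -(mul1e v%:E) -(iint_cube w t0); apply: (frame_vol_ge UU) => //.
    exact: rv_mset_cube.
  move=> y /hw [yD ys]; split=> //; first by rewrite /pball /=; lra.
  have y0 := sqnorm_ge0 y.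
  rewrite -[leLHS](expr1n _ m.+2) lerXn2r ?nnegrE// ?divr_ge0//; first by lra.
  by rewrite ler_pdivlMr ?mul1r; lra.
have vfin : v%:E \is a fin_num by [].
rewrite -(leeD2rE _ _ vfin).
apply: le_trans (leeD2l _ up).
exact: le_trans (leeD2l _ lo) cmp.
Qed.

(** [L] and the caps are disjoint, since the caps lie beyond radius [r], and both lie in the union
    of [K] and the collar. The caps outweigh the collar. *)
Lemma volume_lt :
  8 ^+ m.+3 < (2 / (1 - r ^+ 2)) ^+ m.+3 * ((r' ^+ m.+3 - r ^+ m.+3) *
     fine (vol (@double_cone R m.+2 `&` @oball R m.+3 1))) ->
  (hvol L < hvol K)%E.
Proof.
rewrite !hvolE; set I := (1%:M : 'M[R]_m.+3) => big.
have II : I *m I^T = 1%:M by rewrite trmx1 mulmx1.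
have cube01 (y : 'rV[R]_m.+3) : sqnorm y < 1 -> cube 0 1 y.
  move=> y1 i; rewrite mxE subr0 -(@ler_pXn2r _ 2)// ?nnegrE// expr1n real_normK ?num_real//.
  exact: le_trans (sqnorm_coord_le y i) (ltW y1).
have cmp : (frame_vol I m.+3 L + frame_vol I m.+3 caps <=
            frame_vol I m.+3 K + frame_vol I m.+3 collar)%E.
  apply: frame_vol_le4 => //.
  - move=> x xL; have [xw|xw] := pselect (waist x); last by right.
    by left; split; [exact: oball_le xL.1|split=> //; exact: xL.2].
  - by move=> x [/double_cone_sub[xb xw] [xr' _]]; left.
  - by apply/seteqP; split=> // x [[xr _] [_ [_]]].
have up : (frame_vol I m.+3 collar <= (8 ^+ m.+3)%:E)%E.
  (* On the collar the conformal factor is at most [10/3 <= 4], and the collar lies in a cube of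
     side [2]. *)
  have -> : 8 ^+ m.+3 = 4 ^+ m.+3 * (2 * 1) ^+ m.+3 :> R.
    by rewrite -exprMn; congr (_ ^+ _); ring.
  rewrite EFinM -(iint_cube (0 : 'rV[R]_m.+3) ler01); apply: (frame_vol_le II) => //.
    exact: rv_mset_cube.
  move=> y yb; rewrite mulmx1 => -[[_ ybu] nw].
  split; first exact: cube01.
  apply: (@le_trans _ _ ((2 / (1 - 2 / 5)) ^+ m.+3)).
    by apply: hdens_le; [exact: collar_bounded|lra].
  have -> : 2 / (1 - 2 / 5) = 10 / 3 :> R by field; lra.
  by rewrite lerXn2r ?nnegrE//; lra.
have lo : (((2 / (1 - r ^+ 2)) ^+ m.+3 * ((r' ^+ m.+3 - r ^+ m.+3) *
     fine (vol (@double_cone R m.+2 `&` @oball R m.+3 1))))%:E <= frame_vol I m.+3 caps)%E.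
  rewrite EFinM -vol_cone_shell ?(ltW rr')//; last 2 first.
  - exact: rv_mset_double_cone.
  - by move=> c x; exact: double_coneZ.
  apply: (frame_vol_ge II) => //; first by rewrite exprn_ge0// divr_ge0// subr_ge0 ltW.
  move=> y yA; have [_ [yr' /negP]] := yA; rewrite -ltNge => yr.
  have y1 : sqnorm y < 1 by exact: le_lt_trans r'2lt1.
  by rewrite mulmx1; split=> //; apply: hdens_ge => //; exact: ltW.
(* Finiteness is what makes adding the volume of [L] preserve the strict inequality in the extended
   reals. *)
have finL : (frame_vol I m.+3 L \is a fin_num)%E.
  rewrite ge0_fin_numE; last by apply: iint_ge0 => y; rewrite lee_fin (frame_dens_ge0 II).
  apply: (@le_lt_trans _ _ (((2 / (1 - r ^+ 2)) ^+ m.+3)%:E * vol (cube (0 : 'rV[R]_m.+3) 1))%E).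
    apply: (frame_vol_le II) => //; first exact: rv_mset_cube.
      by rewrite exprn_ge0// divr_ge0// subr_ge0 ltW.
    move=> y yb; rewrite mulmx1 => -[yr _]; split; first exact: cube01.
    exact: hdens_le.
  by rewrite /vol iint_cube// -EFinM ltry.
rewrite -(lteD2rE (x := (8 ^+ m.+3)%:E))//.
apply: lt_le_trans (leeD2l _ up).
apply: lt_le_trans cmp.
apply: lt_le_trans (leeD2l _ lo).
by rewrite lteD2lE// lte_fin.
Qed.

End Pair.
End Comparison.

Theorem theorem2 (R : realType) (n : nat) (hn : (3 <= n)%N) :
  exists K L : set 'rV[R]_n,
    [/\ hbody K, hconvex K & csym K] /\ [/\ hbody L, hconvex L & csym L] /\
    (forall (xi : 'rV[R]_n) (U : 'M[R]_(n.-1, n)),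
        sqnorm xi = 1 -> hyperplane_frame xi U ->
        (hvol_sec U K <= hvol_sec U L)%E) /\
    (hvol L < hvol K)%E.
Proof.
case: n hn => [|[|[|m]]] // _.
have v0 : 0 < (2 * (1 / (200 * (m.+2)%:R))) ^+ m.+2 :> R.
  by rewrite exprn_gt0// mulr_gt0// divr_gt0// mulr_gt0.
have E0 : 0 <= fine (vol (setT `&` @oball R m.+2 1)) by rewrite fine_ge0// vol_ge0.
have M0 : 0 <= 8 ^+ m.+3 :> R by rewrite exprn_ge0.
(* Here [v] is the volume of the collar cube, [E] that of the unit ball in dimension [n - 1],
   [kappa] that of the double cone in the unit ball, and [M] the bound for the collar. *)
have [r [r' [r910 rr' r'1 small big]]] :=
  thin_shell (ltn0Sn m.+1) v0 E0 (vol_cone_gt0 R m.+2) M0.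
have r2 : 1 / 2 <= r by apply: le_trans r910; clear; lra.
have r0 : 0 < r by apply: lt_le_trans r2; clear; lra.
have r1 : r < 1 := lt_trans rr' r'1.
have r01 : 0 < r < 1 by rewrite r0.
have r'01 : 0 < r' < 1 by rewrite (lt_trans r0 rr').
exists (Kbody r'), (Lbody r); split; last split; last split.
- split; [|exact: Kbody_convex|exact: Kbody_csym].
  by apply: Kbody_body; rewrite (le_trans r2 (ltW rr')).
- split; [|exact: Lbody_convex|exact: Lbody_csym].
  by apply: Lbody_body; rewrite r2.
- by move=> xi U _ [UU _]; exact: section_le.
- exact: volume_lt.
Qed.
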